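(* Let $\boldsymbol{X} = (X_0, X_1, \ldots)$ be an upward run chain on the poset $(S, \preceq)$ with transition function $P$, and suppose that $\boldsymbol{X}$ is recurrent. Define $F: S \to (0,1]$ by $F(x) = \mathbb{P}_e(T_x \le T_e)$. Then $F$ is left-invariant for $P$, that is, $\sum_{x \in S} F(x) P(x, y) = F(y)$ for every $y \in S$.
   Context: $(S, \preceq)$ is a discrete (countable) partially ordered set with a minimum element $e$, such that for every $x \in S$ every chain (totally ordered subset) in $S$ from $e$ to $x$ is finite. An element $y$ covers $x$ if $y$ is a minimal element of $\{t \in S : t \succ x\}$. For $x \in S$, $A_x = \{y \in S : y \text{ covers } x\}$ (possibly empty or infinite) and $B_x = \{w \in S : x \text{ covers } w\}$. An upward run chain on $(S, \preceq)$ is a (time-homogeneous, discrete-time) Markov chain on $S$ whose transition function $P$ satisfies $P(x,y) > 0$ if and only if $y \in A_x$ or $y = e$ (so $P(x,e) = 1 - \sum_{y \in A_x} P(x,y) > 0$). Such a chain is irreducible and aperiodic. $\mathbb{P}_e$ denotes probability given $X_0 = e$, and $T_x = \min\{n \ge 1 : X_n = x\}$ is the first positive hitting time of $x$ (with $\min\emptyset = \infty$). *)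

(* Defs.v *)
From HB Require Import structures.
From mathcomp Require Import all_boot all_order all_algebra.
From mathcomp Require Import all_classical all_reals all_analysis.

Set Implicit Arguments.
Unset Strict Implicit.
Unset Printing Implicit Defensive.

Import Order.TTheory GRing.Theory Num.Theory.

Local Open Scope classical_set_scope.
Local Open Scope ring_scope.

Definition is_minimal_of {disp : Order.disp_t} {S : porderType disp}
    (A : set S) (y : S) : Prop :=
  A y /\ forall t, A t -> (t <= y)%O -> t = y.

Definition covers {disp : Order.disp_t} {S : porderType disp}
    (y x : S) : Prop :=
  is_minimal_of [set t | (x < t)%O] y.

Definition cover_set {disp : Order.disp_t} {S : porderType disp}
    (x : S) : set S := [set y | covers y x].

Definition chain_from_to {disp : Order.disp_t} {S : porderType disp}
    (a b : S) (C : set S) : Prop :=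
  [/\ total_on C (fun s t => (s <= t)%O), C a, C b
    & forall t, C t -> (a <= t <= b)%O].

Definition is_transition_function {R : realType} {S : choiceType}
    (P : S -> S -> R) : Prop :=
  (forall x y, 0 <= P x y) /\
  (forall x, \esum_(y in [set: S]) (P x y)%:E = 1%E).

(* [Pr x] is the law "P_x" under which the chain starts at [x]. The space [S]
   is countable and carries its discrete sigma-algebra. The Markov property is
   the usual P(X_{n+1} = s_{n+1} | X_0 = s_0, .., X_n = s_n) = P(s_n, s_{n+1}),
   multiplied out so that histories of probability zero need no side
   condition. *)
Record is_markov_chain {R : realType} {S : choiceType}
    {d : measure_display} {Omega : measurableType d}
    (X : nat -> Omega -> S) (Pr : S -> probability Omega R)
    (P : S -> S -> R) : Prop := IsMarkovChain {
  mc_measurable : forall n (A : set S), measurable (X n @^-1` A) ;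
  mc_transition : is_transition_function P ;
  mc_initial : forall x, Pr x [set w | X 0%N w = x] = 1%E ;
  mc_markov : forall x n (s : nat -> S),
    Pr x [set w | forall i, (i <= n.+1)%N -> X i w = s i] =
    (Pr x [set w | forall i, (i <= n)%N -> X i w = s i]
       * (P (s n) (s n.+1))%:E)%E }.

(* The infimum of the empty set is [+oo]. *)
Definition hitting_time {R : realType} {S : choiceType} {Omega : Type}
    (X : nat -> Omega -> S) (x : S) (w : Omega) : \bar R :=
  ereal_inf [set (n%:R)%:E | n in [set n | (1 <= n)%N /\ X n w = x]].

Definition recurrent {R : realType} {S : choiceType}
    {d : measure_display} {Omega : measurableType d}
    (X : nat -> Omega -> S) (Pr : S -> probability Omega R) : Prop :=
  forall x, Pr x [set w | (hitting_time X x w < +oo :> \bar R)%E] = 1%E.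

Definition left_invariant {R : realType} {S : choiceType}
    (P : S -> S -> R) (f : S -> R) : Prop :=
  forall y, \esum_(x in [set: S]) (f x * P x y)%:E = (f y)%:E.

Definition is_upward_run_chain {R : realType} {disp : Order.disp_t}
    {S : bPOrderType disp} {d : measure_display} {Omega : measurableType d}
    (X : nat -> Omega -> S) (Pr : S -> probability Omega R)
    (P : S -> S -> R) : Prop :=
  is_markov_chain X Pr P /\
  forall x y, 0 < P x y <-> (cover_set x y \/ y = \bot%O).

Definition hit_prob {R : realType} {disp : Order.disp_t}
    {S : bPOrderType disp} {d : measure_display} {Omega : measurableType d}
    (X : nat -> Omega -> S) (Pr : S -> probability Omega R) (x : S) : R :=
  fine (Pr \bot%O [set w |
    (hitting_time X x w <= hitting_time X \bot%O w :> \bar R)%E]).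

(* Main.v *)
Require Import Defs.
From HB Require Import structures.
From mathcomp Require Import all_boot all_order all_algebra.
From mathcomp Require Import all_classical all_reals all_analysis.

Set Implicit Arguments.
Unset Strict Implicit.
Unset Printing Implicit Defensive.

Import Order.TTheory GRing.Theory Num.Theory.

Local Open Scope classical_set_scope.
Local Open Scope ring_scope.

(** Between two visits to the minimum e an upward run chain climbs strictly
from cover to cover, so it meets each state at most once per excursion.  Hence
F(x) = P_e(T_x <= T_e) is not only the probability of meeting x during the
first excursion, but also the expected number of visits to x in that
excursion, counting the start at e and not the return:

  F(x) = sum_n P_e(X_n = x, T_e > n).

That occupation measure is the classical invariant measure of a recurrent
chain.  Multiplying by P(x, y), summing over x and using the Markov property
moves the time by one, and gives

  sum_x F(x) P(x, y) = sum_n P_e(X_(n+1) = y, T_e > n).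

The right-hand side counts the arrivals at y during the first excursion, this
time including the return to e.  For every y the arrivals at different times
are almost surely incompatible ([arrival_once]), so the sum is the probability
that some arrival at y occurs, and by recurrence this is F(y)
([hit_prob_bigcup]).  Both sums therefore represent F: they differ only in
whether the visit to e at time 0 or the one at time T_e is counted
([hit_prob_visits] and [hit_prob_arrivals]).

Positivity of F follows from the invariance itself: F(e) = 1, and if y covers
x, then F(y) >= F(x) P(x, y).  Since chains from e to x are finite, every x
is reached from e by finitely many covers ([cover_induction]). *)

(** * Sums over arbitrary index types and countable partitions *)

Lemma esum_exchange (R : realType) (T1 T2 : choiceType)
    (a : T1 -> T2 -> \bar R) : (forall i j, (0 <= a i j)%E) ->
  \esum_(i in [set: T1]) \esum_(j in [set: T2]) a i j =
  \esum_(j in [set: T2]) \esum_(i in [set: T1]) a i j.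
Proof.
move=> a0; rewrite !esum_esum//.
rewrite (reindex_esum ([set: T2] `*`` (fun=> [set: T1])) _
  (fun x => (x.2, x.1)))//; split=> //=.
- by move=> [i1 i2] [j1 j2] _ _ /= [-> ->].
- by move=> [i1 i2] _; exists (i2, i1).
Qed.

(** Half of [esumZr]; the other half is this one for the factor [c^-1]. *)
Lemma esumZr_le (R : realType) (T : choiceType) (I : set T)
    (a : T -> \bar R) (c : R) :
  0 <= c -> (forall i, (0 <= a i)%E) ->
  (\esum_(i in I) (a i * c%:E) <= (\esum_(i in I) a i) * c%:E)%E.
Proof.
move=> c0 a0; apply: ge_ereal_sup => _ [X fX <-].
rewrite -ge0_mule_fsuml//; apply: lee_wpmul2r; first by rewrite lee_fin.
by apply: ereal_sup_ubound; exists X.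
Qed.

Lemma esumZr (R : realType) (T : choiceType) (I : set T)
    (a : T -> \bar R) (c : R) :
  0 <= c -> (forall i, (0 <= a i)%E) ->
  (\esum_(i in I) (a i * c%:E) = (\esum_(i in I) a i) * c%:E)%E.
Proof.
move=> c0 a0; apply/eqP; rewrite eq_le esumZr_le//=.
have [->|cn0] := eqVneq c 0.
  by rewrite mule0 esum_ge0// => i _; rewrite mule0.
rewrite -[leRHS]mule1 -[1%E]/(1%R)%:E -(mulVf cn0) EFinM muleA.
apply: lee_wpmul2r; first by rewrite lee_fin.
have -> : \esum_(i in I) a i =
    \esum_(i in I) (a i * c%:E * c^-1%:E)%E.
  by apply: eq_esum => i _; rewrite -muleA -EFinM divff// mule1.
apply: esumZr_le; first by rewrite invr_ge0.
by move=> i; rewrite mule_ge0// lee_fin.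
Qed.

Lemma measure_countable_partition d (T : measurableType d) (R : realType)
    (mu : {measure set T -> \bar R}) (S : choiceType) (f : T -> S) (A : set T) :
  countable [set: S] ->
  (forall s, measurable (f @^-1` [set s])) -> measurable A ->
  mu A = \esum_(s in [set: S]) mu (A `&` f @^-1` [set s]).
Proof.
move=> /countable_injP[c cinj] mf mA.
have cK s t : c s = c t -> s = t by apply: cinj; rewrite inE.
(* Sigma-additivity is indexed by naturals: partition along the code of [f]. *)
pose B n := A `&` [set w | c (f w) = n].
have BE s : B (c s) = A `&` f @^-1` [set s].
  by apply/seteqP; split=> w [Aw /= h]; split=> //=; [exact: cK|rewrite h].
have B0 n : ~ range c n -> B n = set0.
  by move=> cn; apply/seteqP; split=> // w [_ /= wn]; apply: cn; exists (f w).
have mB n : measurable (B n).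
  case: (pselect (range c n)) => [[s _ <-]|/B0->//].
  by rewrite BE; exact: measurableI.
have -> : mu A = mu (\bigcup_n B n).
  congr (mu _); apply/seteqP; split=> w; first by move=> Aw; exists (c (f w)).
  by move=> [n _ []].
rewrite measure_semi_bigcup//; last 2 first.
- by move=> i j _ _ [w [[_ /= <-] [_ /= <-]]].
- exact: bigcupT_measurable.
rewrite nneseries_esumT//.
transitivity (\esum_(n in range c) mu (B n)).
  rewrite [RHS]esum_mkcond; apply: eq_esum => n _.
  by case: ifPn => //; rewrite notin_setE => /B0->; rewrite measure0.
rewrite esum_image; last by move=> x y _ _; exact: cK.
by apply: eq_esum => s _; rewrite BE.
Qed.

(** Removing from each set the union of the earlier ones makes the family
disjoint, at the cost of a null set. *)
Lemma measure_bigcup_null_overlap d (T : measurableType d) (R : realType)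
    (mu : {measure set T -> \bar R}) (G : (set T)^nat) :
  (forall n, measurable (G n)) ->
  (forall n m, (n < m)%N -> mu (G n `&` G m) = 0%E) ->
  mu (\bigcup_n G n) = \esum_(n in [set: nat]) mu (G n).
Proof.
move=> mG G0; rewrite seqDU_bigcup_eq measure_semi_bigcup//; last 2 first.
- by move=> n; exact: seqDU_measurable.
- by apply: bigcupT_measurable => n; exact: seqDU_measurable.
rewrite nneseries_esumT//; apply: eq_esum => m _; rewrite /seqDU.
have mU : measurable (\big[setU/set0]_(k < m) G k).
  by apply: bigsetU_measurable => k _.
rewrite [RHS](measureDI mu (mG m) mU).
rewrite [X in (_ + X)%E](_ : _ = 0%E) ?adde0//.
apply: (measure_negligible (mu := mu)); first exact: measurableI.
rewrite -bigcup_mkord setI_bigcupr bigcup_mkord.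
rewrite -(big_mkord xpredT (fun k => G m `&` G k)) big_seq_cond.
apply: negligible_bigsetU => k; rewrite mem_index_iota andbT => /= km.
apply/negligibleP; first exact: measurableI.
by rewrite setIC; exact: G0.
Qed.

(** * Hitting times *)

Section hitting_times.
Variables (R : realType) (S : choiceType) (Omega : Type).
Variable X : nat -> Omega -> S.

Lemma hitting_time_lt_pinftyP x w :
  (hitting_time X x w < +oo :> \bar R)%E <-> exists n, X n.+1 w = x.
Proof.
split=> [|[n Xn]].
  move=> /ereal_inf_ltP[_ [n [n0 Xn] <-] _].
  by case: n n0 Xn => // n _ Xn; exists n.
apply: (@le_lt_trans _ _ (n.+1%:R)%:E); last exact: ltry.
by apply: ereal_inf_lbound; exists n.+1.
Qed.

Lemma hitting_time_le_natP x n w :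
  (hitting_time X x w <= n%:R%:E :> \bar R)%E <->
  exists2 k, (k < n)%N & X k.+1 w = x.
Proof.
split=> [h|[k kn Xk]].
  have : (hitting_time X x w < n.+1%:R%:E :> \bar R)%E.
    by apply: le_lt_trans h _; rewrite lte_fin ltr_nat.
  move=> /ereal_inf_ltP[_ [k [k0 Xk] <-]].
  rewrite lte_fin ltr_nat ltnS.
  by case: k k0 Xk => // k _ Xk kn; exists k.
apply: (@le_trans _ _ (k.+1%:R)%:E); last by rewrite lee_fin ler_nat.
by apply: ereal_inf_lbound; exists k.+1.
Qed.

(** The second disjunct covers the case where [z] is never hit, in which the
comparison holds whatever [y] does; the first one allows [y = z]. *)
Lemma hitting_time_leP y z w :
  (hitting_time X y w <= hitting_time X z w :> \bar R)%E <->
  (exists n, X n.+1 w = y /\ forall j, (0 < j <= n)%N -> X j w <> z) \/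
  (forall n, X n.+1 w <> z).
Proof.
split=> [h|[[n [Xn nz]]|nz]].
- case: (pselect (exists n, X n.+1 w == z)) => [ez|nz]; last first.
    by right=> n Xn; apply: nz; exists n; apply/eqP.
  left; case: (ex_minnP ez) => m /eqP Xm minm.
  have [] : exists2 k, (k < m.+1)%N & X k.+1 w = y.
    apply/hitting_time_le_natP; apply: le_trans h _.
    by apply/hitting_time_le_natP; exists m.
  move=> k; rewrite ltnS => km Xk; exists k; split=> // -[//|j] /= jk.
  by move=> /eqP /minm; rewrite leqNgt (leq_trans jk).
- apply: le_ereal_inf_tmp => _ [m [m0 Xm] <-].
  apply/hitting_time_le_natP; exists n => //.
  rewrite ltnNge; apply/negP => mn; apply: (nz m) => //.
  by rewrite m0.
- apply: le_ereal_inf_tmp => _ [m [m0 Xm] <-].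
  by case: m m0 Xm => // m _ /nz.
Qed.

End hitting_times.

(** * The Markov property for history events *)

Section markov_chains.
Context {R : realType} {S : choiceType} {d : measure_display}.
Context {Omega : measurableType d}.
Variables (X : nat -> Omega -> S) (Pr : S -> probability Omega R).
Variable P : S -> S -> R.

Definition history (H : nat -> set S) (n : nat) : set Omega :=
  [set w | forall i, (i <= n)%N -> H i (X i w)].

Hypothesis S_countable : countable [set: S].
Hypothesis mcX : is_markov_chain X Pr P.

Let mX := mc_measurable mcX.

Lemma transition_ge0 x y : (0 <= (P x y)%:E)%E.
Proof. by rewrite lee_fin; have [+ _] := mc_transition mcX; apply. Qed.
#[local] Hint Resolve transition_ge0 : core.

Lemma measurable_history H n : measurable (history H n).
Proof.
have -> : history H n = \bigcap_(i in `I_n.+1) X i @^-1` H i by [].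
by apply: bigcap_measurable => //; exists 0%N.
Qed.
#[local] Hint Resolve measurable_history : core.

Lemma probability_partition x k A : measurable A ->
  Pr x A = \esum_(s in [set: S]) Pr x (A `&` X k @^-1` [set s]).
Proof.
by move=> mA; apply: measure_countable_partition => // s; exact: mX.
Qed.

(** The Markov property is assumed only for fully specified pasts.  It extends
to a past that is merely constrained to [H] by forgetting one instant at a
time: the event is partitioned along the value of the chain at that instant. *)
Lemma markov_history x H n y z :
  Pr x (history H n `&` X n @^-1` [set y] `&` X n.+1 @^-1` [set z]) =
  (Pr x (history H n `&` X n @^-1` [set y]) * (P y z)%:E)%E.
Proof.
(* Constrained to [H] before time [k], and specified by [s] from [k] to [m]. *)
pose E k m (s : nat -> S) :=
  [set w | forall i, (i <= m)%N ->
     if (i < k)%N then H i (X i w) else X i w = s i].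
have EH k m s : E k m s =
    history (fun i => if (i < k)%N then H i else [set s i]) m.
  by apply/seteqP; split=> w Ew i /Ew; case: ifP.
have mE k m s : measurable (E k m s) by rewrite EH.
have markovE k s : (k <= n)%N ->
    Pr x (E k n.+1 s) = (Pr x (E k n s) * (P (s n) (s n.+1))%:E)%E.
  elim: k s => [|k IH] s kn; first exact: mc_markov.
  pose upd u i := if i == k then u else s i.
  have split_at m : (k < m)%N -> forall u, E k.+1 m s `&` X k @^-1` [set u] =
      if u \in H k then E k m (upd u) else set0.
    move=> km u; case: ifPn => [|]; rewrite ?(inE, notin_setE) => Hu.
      apply/seteqP; split=> w /= => [[Ew Xk] i im|Ew].
        have := Ew i im; rewrite ltnS [(i <= k)%N]leq_eqVlt /upd.
        have [->|_] := eqVneq i k => /=; last by [].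
        by rewrite ltnn Xk.
      have Xk : X k w = u by have := Ew k (ltnW km); rewrite ltnn /upd eqxx.
      split=> // i im; have := Ew i im; rewrite ltnS [(i <= k)%N]leq_eqVlt /upd.
      have [->|_] := eqVneq i k => /=; last by [].
      by move=> _; rewrite Xk.
    apply/seteqP; split=> // w /= [Ew Xk].
    by have := Ew k (ltnW km); rewrite leqnn Xk.
  rewrite (@probability_partition x k)//.
  rewrite [in RHS](@probability_partition x k)//.
  have Pn u : P (upd u n) (upd u n.+1) = P (s n) (s n.+1).
    by rewrite /upd !gtn_eqF// ltnW.
  under eq_esum => u _ do rewrite (split_at n.+1 (ltnW kn)).
  under [in RHS]eq_esum => u _ do rewrite (split_at n kn).
  rewrite -esumZr//; last by move: (transition_ge0 (s n) (s n.+1)).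
  apply: eq_esum => u _; case: ifPn => _; last by rewrite measure0 mul0e.
  by rewrite IH ?Pn// ltnW.
(* Once the state at time [n] is known to be [y], the constraint [H n] is either
void or contradictory. *)
have EnE s : s n = y -> s n.+1 = z ->
  history H n `&` X n @^-1` [set y] = if y \in H n then E n n s else set0.
  move=> sn sz; case: ifPn => [|]; rewrite ?(inE, notin_setE) => Hy.
    apply/seteqP; split=> w /= => [[Hw Xn] i im|Ew].
      case: ltnP => [_|nim]; first exact: Hw.
      by have -> : i = n by [apply/eqP; rewrite eqn_leq im nim]; rewrite Xn sn.
    have Xn : X n w = y by have := Ew n (leqnn n); rewrite ltnn sn.
    split=> // i im; have := Ew i im; case: ltnP => // nim _.
    by have -> : i = n by [apply/eqP; rewrite eqn_leq im nim]; rewrite Xn.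
  by apply/seteqP; split=> // w /= [Hw Xn]; have := Hw n (leqnn n); rewrite Xn.
pose s i := if i == n.+1 then z else y.
have sn : s n = y by rewrite /s ltn_eqF.
have sz : s n.+1 = z by rewrite /s eqxx.
have EnS : E n n s `&` X n.+1 @^-1` [set z] = E n n.+1 s.
  apply/seteqP; split=> w /= => [[Ew Xz] i|Ew].
    rewrite leq_eqVlt ltnS => /orP[/eqP ->|]; last exact: Ew.
    by rewrite ltnNge leqnSn/= sz.
  split=> [i im|]; first exact/Ew/leqW.
  by have := Ew n.+1 (leqnn _); rewrite ltnNge leqnSn/= sz.
rewrite (EnE s)//; case: ifPn => _; last by rewrite set0I measure0 mul0e.
by rewrite EnS markovE// sn sz.
Qed.

Lemma history_next x H n z :
  Pr x (history H n `&` X n.+1 @^-1` [set z]) =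
  \esum_(y in [set: S])
    (Pr x (history H n `&` X n @^-1` [set y]) * (P y z)%:E)%E.
Proof.
rewrite (@probability_partition x n); last exact: measurableI.
by apply: eq_esum => y _; rewrite -markov_history setIAC.
Qed.

End markov_chains.

(** * Excursions from the minimum *)

Section upward_run_chains.
Context {R : realType} {disp : Order.disp_t} {S : bPOrderType disp}.
Context {d : measure_display} {Omega : measurableType d}.
Variables (X : nat -> Omega -> S) (Pr : S -> probability Omega R).
Variable P : S -> S -> R.

Local Notation e := (\bot%O : S).

(** Time 0 is exempted, because an excursion starts at the minimum. *)
Definition off_root (i : nat) : set S := [set t | (0 < i)%N -> t <> e].

Definition excursion (n : nat) : set Omega := history X off_root n.

Definition arrival (n : nat) (y : S) : set Omega :=
  excursion n `&` X n.+1 @^-1` [set y].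

Hypothesis S_countable : countable [set: S].
Hypothesis runX : is_upward_run_chain X Pr P.

Let mcX : is_markov_chain X Pr P := proj1 runX.
Let mX := mc_measurable mcX.

Lemma transition_eq0 x y : ~ covers y x -> y <> e -> P x y = 0.
Proof.
move=> xy ye; apply/eqP; rewrite eq_le -!lee_fin (transition_ge0 mcX) andbT.
rewrite lee_fin leNgt; apply/negP => /(proj2 runX)[]; first exact: xy.
exact: ye.
Qed.

(** [subset_measure0] with [Pr s] kept as a probability, the form in which
[history_next] rewrites it. *)
Lemma probability_null_subset s (A B : set Omega) :
  measurable A -> measurable B -> A `<=` B -> Pr s B = 0%E -> Pr s A = 0%E.
Proof. by move=> mA mB; exact: subset_measure0. Qed.

(** Away from the minimum, only transitions to covers have positive probability,
so by induction on the elapsed time an excursion never leaves the up-set of a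
state that it has visited. *)
Lemma excursion_monotone s k x m z : (k <= m)%N -> ~~ (x <= z)%O ->
  Pr s (history X (fun i => off_root i `&` [set t | i = k -> t = x]) m
        `&` X m @^-1` [set z]) = 0%E.
Proof.
move=> km; elim: m km z => [|m IH] km z xz.
  move: km; rewrite leqn0 => /eqP k0.
  rewrite [X in Pr s X](_ : _ = set0) ?measure0//.
  apply/seteqP; split=> // w /= [Hw Xz]; have [_ /=] := Hw 0%N isT.
  by rewrite Xz k0 => /(_ erefl) zx; rewrite zx lexx in xz.
set H := fun i => _.
have [mk|mk] := eqVneq m.+1 k.
  rewrite [X in Pr s X](_ : _ = set0) ?measure0//.
  apply/seteqP; split=> // w /= [Hw Xz]; have [_ /=] := Hw m.+1 (leqnn _).
  by rewrite Xz => /(_ mk) zx; rewrite zx lexx in xz.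
have {mk}km' : (k <= m)%N by rewrite -ltnS ltn_neqAle eq_sym mk.
have [->|/eqP ze] := eqVneq z e.
  rewrite [X in Pr s X](_ : _ = set0) ?measure0//.
  apply/seteqP; split=> // w /= [Hw Xz].
  by have [/(_ isT)] := Hw m.+1 (leqnn _); rewrite Xz.
apply: (@probability_null_subset s _ (history X H m `&` X m.+1 @^-1` [set z])).
- by apply: measurableI => //; exact: (measurable_history mcX).
- by apply: measurableI => //; exact: (measurable_history mcX).
- by apply: setSI => w Hw i im; apply: Hw; exact: leqW.
rewrite (history_next S_countable mcX).
apply: esum1 => u _; have [xu|xu] := boolP (x <= u)%O.
  rewrite (transition_eq0 (x := u)) ?mule0// => -[/= uz _].
  by rewrite (le_trans xu (ltW uz)) in xz.
by rewrite IH// mul0e.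
Qed.

Lemma measurable_arrival n y : measurable (arrival n y).
Proof. by apply: measurableI => //; exact: (measurable_history mcX). Qed.

(** Arrivals at the minimum exclude each other because an excursion avoids it.
For any other [y], the chain would be at some [u >= y] just before the second
arrival, and no such [u] is covered by [y]. *)
Lemma arrival_once s n m y : (n < m)%N ->
  Pr s (arrival n y `&` arrival m y) = 0%E.
Proof.
move=> nm; pose H i := off_root i `&` [set t | i = n.+1 -> t = y].
apply: (@probability_null_subset s _ (history X H m `&` X m.+1 @^-1` [set y])).
- by apply: measurableI => //; exact: measurable_arrival.
- by apply: measurableI => //; exact: (measurable_history mcX).
- move=> w [[_ /= Xn] [Em /= Xm]]; split=> // i im.
  by split; [exact: Em|move=> /= ->].
have [ye|/eqP ye] := eqVneq y e.
  rewrite [X in Pr s X](_ : _ = set0) ?measure0//.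
  apply/seteqP; split=> // w /= [Hw _].
  by have [+ /(_ erefl)] := Hw n.+1 nm => /(_ isT); rewrite ye.
rewrite (history_next S_countable mcX).
apply: esum1 => u _; have [yu|yu] := boolP (y <= u)%O.
  rewrite (transition_eq0 (x := u)) ?mule0// => -[/= uy _].
  by have := le_lt_trans yu uy; rewrite ltxx.
by rewrite (@excursion_monotone s n.+1 y m u nm yu) mul0e.
Qed.

Lemma arrival_next s n y : Pr s (arrival n y) =
  \esum_(x in [set: S])
    (Pr s (excursion n `&` X n @^-1` [set x]) * (P x y)%:E)%E.
Proof. exact: (history_next S_countable mcX). Qed.

Lemma excursion_avoids_root s n :
  Pr s (excursion n.+1 `&` X n.+1 @^-1` [set e]) = 0%E.
Proof.
rewrite [X in Pr s X](_ : _ = set0) ?measure0//.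
apply/seteqP; split=> // w /= [Hw Xe].
by have /(_ isT) := Hw n.+1 (leqnn _).
Qed.

Lemma arrival_off_root n y : y <> e ->
  arrival n y = excursion n.+1 `&` X n.+1 @^-1` [set y].
Proof.
move=> ye; apply/seteqP; split=> w /= [Ew Xn]; split=> // i.
  by rewrite leq_eqVlt => /orP[/eqP -> _|]; [rewrite Xn|exact: Ew].
by move=> im; apply: Ew; exact: leqW.
Qed.

Hypothesis recX : recurrent X Pr.

(** The event [T_y <= T_e] also contains the paths that never return to the
minimum; recurrence makes them negligible. *)
Lemma hit_prob_bigcup y :
  (hit_prob X Pr y)%:E = Pr e (\bigcup_n arrival n y).
Proof.
have mG : measurable (\bigcup_n arrival n y).
  by apply: bigcupT_measurable => n; exact: measurable_arrival.
pose N : set Omega := ~` [set w | (hitting_time X e w < +oo :> \bar R)%E].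
have NE : N = \bigcap_n X n.+1 @^-1` [set t | t <> e].
  apply/seteqP; split=> w /=.
    move=> Nw n _ Xn; apply: Nw.
    by rewrite /= hitting_time_lt_pinftyP; exists n.
  by move=> Nw; rewrite /N /= hitting_time_lt_pinftyP => -[n]; exact: Nw.
have mN : measurable N by rewrite NE; apply: bigcapT_measurable => n; exact: mX.
have N0 : Pr e N = 0%E.
  rewrite probability_setC; first by rewrite recX subee.
  by rewrite -[X in measurable X]setCK; exact: measurableC.
rewrite /hit_prob.
have -> : [set w | (hitting_time X y w <= hitting_time X e w :> \bar R)%E] =
          \bigcup_n arrival n y `|` N.
  rewrite NE; apply/seteqP; split=> w /=; rewrite hitting_time_leP.
    case=> [[n [Xn Xe]]|Xe]; [left|right].
      by exists n => //; split=> // i im i0; apply: Xe; rewrite i0.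
    by move=> n _; exact: Xe.
  case=> [[n _ [En Xn]]|Xe]; [left|right].
    by exists n; split=> // j /andP[j0 jn]; exact: En.
  by move=> n; exact: Xe.
rewrite fineK; first exact: measureU0.
exact: fin_num_measure (measurableU _ _ mG mN).
Qed.

Lemma hit_prob_arrivals y :
  ((hit_prob X Pr y)%:E = \esum_(n in [set: nat]) Pr e (arrival n y))%E.
Proof.
rewrite hit_prob_bigcup; apply: measure_bigcup_null_overlap.
- by move=> n; exact: measurable_arrival.
- by move=> n m; exact: arrival_once.
Qed.

Lemma hit_prob_root : hit_prob X Pr e = 1.
Proof.
rewrite /hit_prob (_ : [set w | _] = setT) ?probability_setT//.
by apply/seteqP; split=> // w _ /=.
Qed.

Lemma hit_prob_le1 y : hit_prob X Pr y <= 1.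
Proof.
rewrite -lee_fin hit_prob_bigcup; apply: probability_le1.
by apply: bigcupT_measurable => n; exact: measurable_arrival.
Qed.

(** Off the minimum an arrival at time [n.+1] is a visit at time [n.+1], and
there is no visit at time 0.  At the minimum the visit at time 0 is the only
one. *)
Lemma hit_prob_visits x : ((hit_prob X Pr x)%:E =
  \esum_(n in [set: nat]) Pr e (excursion n `&` X n @^-1` [set x]))%E.
Proof.
have start y : Pr e (excursion 0 `&` X 0%N @^-1` [set y]) = (y == e)%:R%:E.
  have [->|/eqP ye] := eqVneq y e; last first.
    apply: (@probability_null_subset e _ (~` [set w | X 0%N w = e])).
    - by apply: measurableI => //; exact: (measurable_history mcX).
    - by apply: measurableC; exact: (mX 0%N [set e]).
    - by move=> w [_ /= ->].
    - rewrite probability_setC; last exact: (mX 0%N [set e]).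
      by rewrite (mc_initial mcX) subee.
  rewrite [X in Pr e X](_ : _ = [set w | X 0%N w = e]) ?(mc_initial mcX)//.
  apply/seteqP; split=> w /=; first by case.
  by move=> X0; split=> // i; rewrite leqn0 => /eqP ->.
rewrite -nneseries_esumT// nneseries_recl// start.
rewrite -[1%N]addn0 -nneseries_addn//.
have [->|/eqP xe] := eqVneq x e.
  rewrite hit_prob_root eseries0 ?adde0// => n _ _; rewrite addn1.
  exact: excursion_avoids_root.
rewrite add0e hit_prob_arrivals -nneseries_esumT//.
by apply: eq_eseriesr => n _; rewrite addn1 arrival_off_root.
Qed.

Lemma hit_prob_left_invariant : left_invariant P (hit_prob X Pr).
Proof.
move=> y; rewrite hit_prob_arrivals.
rewrite (eq_esum (fun n _ => arrival_next e n y)).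
rewrite esum_exchange; last first.
  by move=> n x; rewrite mule_ge0//; exact: (transition_ge0 mcX).
apply: eq_esum => x _; rewrite EFinM hit_prob_visits esumZr//.
by rewrite -lee_fin; exact: (transition_ge0 mcX).
Qed.

(** The invariance at [y] bounds F(y) from below by its single term
F(x) P(x, y). *)
Lemma hit_prob_cover x y : covers y x ->
  0 < hit_prob X Pr x -> 0 < hit_prob X Pr y.
Proof.
move=> xy Fx; rewrite -lte_fin -hit_prob_left_invariant.
apply: (@lt_le_trans _ _ (hit_prob X Pr x * P x y)%:E).
  by rewrite lte_fin mulr_gt0//; apply/(proj2 runX); left.
apply: esum_ge; exists [set x]; last by rewrite fsbig_set1.
by split=> //; exact: finite_set1.
Qed.

End upward_run_chains.

(** * Reaching every state by covers *)

Lemma finite_set_extremal (T : choiceType) (r : T -> T -> Prop) (A : set T) :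
  (forall t, ~ r t t) -> (forall s t u, r s t -> r t u -> r s u) ->
  finite_set A -> A !=set0 ->
  exists2 m, A m & forall t, A t -> ~ r m t.
Proof.
move=> irr tr /finite_seqP[s ->] [a]; elim: s a => //= b s IH a _.
case: (pselect (exists a, a \in s)) => [[c cs]|s0]; last first.
  exists b; first exact: mem_head.
  move=> t /=; rewrite inE => /predU1P[->|ts]; first exact: irr.
  by case: s0; exists t.
have [m /= ms maxm] := IH c cs.
case: (pselect (r m b)) => rmb.
  exists b; first exact: mem_head.
  move=> t /=; rewrite inE => /predU1P[->|ts]; first exact: irr.
  by move=> /(tr _ _ _ rmb); exact: maxm.
exists m; first by rewrite /= inE ms orbT.
by move=> t /=; rewrite inE => /predU1P[->//|]; exact: maxm.
Qed.

(** A maximal chain between the minimum and [x], given by Zorn's lemma, is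
finite.  If [b] is its greatest element in [Q] and [b] is not [x], then the
next element [c] of the chain covers [b], as anything strictly between them
could be added to the chain; so [c] is in [Q] too. *)
Lemma cover_induction (disp : Order.disp_t) (S : bPOrderType disp) (Q : set S) :
  (forall (x : S) (C : set S), chain_from_to \bot%O x C -> finite_set C) ->
  Q \bot%O -> (forall x y, covers y x -> Q x -> Q y) -> forall x, Q x.
Proof.
move=> fin_chains Q0 Qcov x.
(* The endpoints are not imposed: maximality puts them in the chain. *)
pose Ch (C : set S) := total_on C (fun s t => (s <= t)%O) /\
                       forall t, C t -> (t <= x)%O.
have [|C [[totC Cx] maxC]] := @Zorn_bigcup S Ch.
  move=> F FCh totF; split=> [s t [A FA As] [B FB Bt]|t [A FA At]]; last first.
    by have [_] := FCh _ FA; apply.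
  have [AB|BA] := totF _ _ FA FB.
    by have [+ _] := FCh _ FB; apply => //; exact: AB.
  by have [+ _] := FCh _ FA; apply => //; exact: BA.
have memC z : (z <= x)%O -> (forall t, C t -> (z <= t)%O \/ (t <= z)%O) -> C z.
  move=> zx zC; apply: contrapT => Cz; apply: (maxC (z |` C)).
    split; first by move=> t Ct; right.
    by move=> /(_ z) /(_ (or_introl erefl)).
  split=> [s t [->|Cs] [->|Ct]|t [->//|]]; last exact: Cx.
  - by left.
  - exact: zC.
  - by have [] := zC _ Cs; [right|left].
  - exact: totC.
have C0 : C \bot%O by apply: memC => [|t _]; [exact: le0x|left; exact: le0x].
have CxC : C x by apply: memC => // t /Cx; right.
have finC : finite_set C.
  by apply: (fin_chains x); split=> // t /Cx ->; rewrite le0x.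
have [b [Cb Qb] maxb] : exists2 b, (C `&` Q) b &
    forall t, (C `&` Q) t -> ~ (b < t)%O.
  apply: finite_set_extremal; last by exists \bot%O.
  - by move=> t; rewrite ltxx.
  - by move=> s t u; exact: lt_trans.
  - by apply: sub_finite_set finC => t [].
have [<-//|bx] := eqVneq b x.
have [c [Cc bc] minc] : exists2 c, (C `&` [set t | (b < t)%O]) c &
    forall t, (C `&` [set t | (b < t)%O]) t -> ~ (t < c)%O.
  apply: finite_set_extremal.
  - by move=> t; rewrite ltxx.
  - by move=> s t u ts ut; exact: lt_trans ut ts.
  - by apply: sub_finite_set finC => t [].
  - by exists x; split=> //=; rewrite lt_neqAle bx Cx.
case: (maxb c) => //; split=> //; apply: Qcov Qb; split=> // t /= bt tc.
apply: contrapT => /eqP tc'.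
have {tc'}tc' : (t < c)%O by rewrite lt_neqAle tc'.
apply: (minc t) => //; split=> //; apply: memC.
  exact: le_trans tc (Cx _ Cc).
move=> s Cs; have [sb|bs] := totC _ _ Cs Cb.
  by right; exact: le_trans sb (ltW bt).
have [->|sb] := eqVneq s b; first by right; exact: ltW.
have bs' : (b < s)%O by rewrite lt_neqAle eq_sym sb.
left; apply: le_trans tc _; have [//|sc] := totC _ _ Cc Cs.
have [->//|sc'] := eqVneq s c.
by case: (minc s); rewrite // lt_neqAle sc' sc.
Qed.

(** * Invariance of the hitting probabilities *)

Theorem proposition1 (R : realType)
    (disp : Order.disp_t) (S : bPOrderType disp)
    (S_countable : countable [set: S])
    (S_finite_chains : forall (x : S) (C : set S),
       chain_from_to \bot%O x C -> finite_set C)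
    (d : measure_display) (Omega : measurableType d)
    (X : nat -> Omega -> S) (Pr : S -> probability Omega R)
    (P : S -> S -> R)
    (X_upward_run : is_upward_run_chain X Pr P)
    (X_recurrent : recurrent X Pr) :
  (forall x, 0 < hit_prob X Pr x <= 1) /\
  left_invariant P (hit_prob X Pr).
Proof.
split; last exact: hit_prob_left_invariant.
move=> x; rewrite (hit_prob_le1 X_upward_run)// andbT.
apply: (cover_induction (Q := [set x | 0 < hit_prob X Pr x])) => //=.
- by rewrite hit_prob_root.
- by move=> y z; exact: (hit_prob_cover S_countable X_upward_run).
Qed.
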